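(* Let $I$ be an ideal on an uncountable Polish space $X$ such that no nonempty open subset of $X$ belongs to $I$, and let $\{U_n:n\in\omega\}$ be a base of open sets of $X$. For $f:X\to X$ let $H_n(f)=\{y\in X: U_n\cap f^{-1}[\{y\}]\notin I\}$. Then: (1) For $x\in X$, $I$ has property (M$'_x$) iff there is a Borel function $f:X\to X$ such that for every $n$ with $x\in U_n$ the set $H_n(f)$ contains a nonempty perfect set. (2) $I$ has property (M$'$) iff there is a Borel $f:X\to X$ such that every $H_n(f)$, $n\in\omega$, contains a nonempty perfect set. (3) $I$ has property (M$^*$) iff there is a Borel $f:X\to X$ such that $\bigcap_{n\in\omega}H_n(f)$ contains a nonempty perfect set. (4) If $I$ is a $\sigma$-ideal and $f:X\to X$ is a Borel function with $f^{-1}[\{x\}]\notin I$ for all $x\in X$ such that each $H_n(f)$ is either countable or contains a nonempty perfect set, then $I$ has property (M$'_x$) for some $x\in X$.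
   Context: Ideals contain all singletons and not the whole space. For $E\subseteq X$, $I$ has (M) rel $E$ if there is a Borel function $g:E\to X$ with $g^{-1}[\{y\}]\notin I$ for every $y\in X$. $I$ has (M$'$) if it has (M) rel $U$ for every nonempty open $U\subseteq X$. For $x\in X$, $I$ has (M$'_x$) if it has (M) rel $U$ for every open neighborhood $U$ of $x$. $I$ has (M$^*$) if there is a Borel $g:X\to X$ such that $g^{-1}[\{y\}]\cap U\notin I$ for every $y\in X$ and every nonempty open $U\subseteq X$.
   Formalization: The members U_n of the base are assumed nonempty; if some U_n were empty, H_n(f) would be empty and the equivalences (2) and (3) would fail, e.g. for the ideal of countable subsets of the Cantor space. *)

(* Defs.v *)
From HB Require Import structures.
From mathcomp Require Import all_boot all_order all_algebra.
From mathcomp Require Import all_classical all_reals all_analysis.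
Set Implicit Arguments. Unset Strict Implicit. Unset Printing Implicit Defensive.
Import Order.TTheory GRing.Theory Num.Theory.
Local Open Scope classical_set_scope.

Definition borel_set {X : topologicalType} (A : set X) : Prop := <<s open >> A.

(* f : E -> X Borel, represented by a total f : X -> X whose values off E are
   irrelevant: for every Borel B, the relative preimage E ∩ f^{-1}[B] is Borel. *)
Definition borel_fun_on {X : topologicalType} (E : set X) (f : X -> X) : Prop :=
  forall B : set X, borel_set B -> borel_set (E `&` f @^-1` B).

Definition borel_fun {X : topologicalType} (f : X -> X) : Prop :=
  borel_fun_on setT f.

Definition is_ideal {X : Type} (I : set (set X)) : Prop :=
  [/\ (forall A B, I B -> A `<=` B -> I A),
      (forall A B, I A -> I B -> I (A `|` B)),
      (forall x : X, I [set x]) & ~ I setT].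

Definition is_sigma_ideal {X : Type} (I : set (set X)) : Prop :=
  is_ideal I /\ (forall A : nat -> set X, (forall n, I (A n)) -> I (\bigcup_n A n)).

(* Polish space: X carries a complete metric compatible with its topology
   (completePseudoMetricType + Hausdorff) and is separable. *)
Definition separable_space (X : topologicalType) : Prop :=
  exists D : set X, countable D /\ dense D.

Definition nonempty_perfect {X : topologicalType} (P : set X) : Prop :=
  perfect_set P /\ P !=set0.

Definition is_base {X : topologicalType} (U : nat -> set X) : Prop :=
  (forall n, open (U n) /\ U n !=set0) /\
  (forall A : set X, open A -> forall x, A x -> exists n, U n x /\ U n `<=` A).

Definition propM {X : topologicalType} (I : set (set X)) (E : set X) : Prop :=
  exists g : X -> X, borel_fun_on E g /\
    forall y : X, ~ I (E `&` g @^-1` [set y]).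

Definition propM' {X : topologicalType} (I : set (set X)) : Prop :=
  forall U : set X, open U -> U !=set0 -> propM I U.

Definition propM'x {X : topologicalType} (I : set (set X)) (x : X) : Prop :=
  forall U : set X, open U -> U x -> propM I U.

Definition propMstar {X : topologicalType} (I : set (set X)) : Prop :=
  exists g : X -> X, borel_fun g /\
    forall (y : X) (U : set X), open U -> U !=set0 -> ~ I (g @^-1` [set y] `&` U).

Definition Hn {X : topologicalType} (I : set (set X)) (U : nat -> set X)
  (f : X -> X) (n : nat) : set X :=
  [set y | ~ I (U n `&` f @^-1` [set y])].

(* Main.v *)
(** A nonempty perfect set P carries a Cantor scheme, which gives a Borel map
    from X to the Cantor space that is onto already on P. Since the Cantor space
    maps onto X by a Borel map, there is a Borel h : X -> X with h[P] = X;
    replacing f by h o f turns "perfectly many positive fibres" into "all fibres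
    positive", which is the right-to-left half of (1)-(3).

    Conversely, X has no isolated points (singletons are in I, open sets are
    not), so X itself is perfect and there is a Borel surjection
    (p, q) : X -> X * X. Composing a witness g of (M) rel E with p or q shows
    that (M) rel E passes to one of the pieces E `&` A, E `\` A, and that E contains
    uncountably many disjoint pieces with (M), the fibres of p o g. Given
    countably many sets E_n with (M), one can therefore remove such a piece
    inside E_0 without destroying (M) for any of the others; iterating yields
    disjoint Borel pieces of the E_n with (M), and the witnesses on these pieces
    are glued to a single f with H_n(f) = X for all n.

    For (4), take y outside all countable H_n(f). The union of the corresponding
    U_n meets the fibre of y in a set of I, so the fibre has a point x outside
    that union, and (1) applies at x. *)

Require Import Defs.
From HB Require Import structures.
From mathcomp Require Import all_boot all_order all_algebra.
From mathcomp Require Import all_classical all_reals all_analysis.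
Import Order.TTheory GRing.Theory Num.Theory.
Local Open Scope classical_set_scope.

(** * Borel sets under countable logical operations, and Borel functions *)

Lemma borel_open (X : topologicalType) (A : set X) : open A -> borel_set A.
Proof. by move=> oA; apply: sub_sigma_algebra. Qed.

Lemma borel_not (X : topologicalType) (A : X -> Prop) :
  borel_set [set x | A x] -> borel_set [set x | ~ A x].
Proof. by move=> /sigma_algebraCD; rewrite setTD. Qed.

Lemma borel_set1 (X : topologicalType) (x : X) :
  hausdorff_space X -> borel_set [set x].
Proof.
move=> /hausdorff_accessible/accessible_closed_set1/(_ x) cx.
have : open (~` [set x]) by rewrite openC.
by move=> /borel_open/borel_not; rewrite -[in X in _ -> X](setCK [set x]).
Qed.

Lemma borel_ex (X : topologicalType) (A : nat -> X -> Prop) :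
  (forall i, borel_set [set x | A i x]) -> borel_set [set x | exists i, A i x].
Proof.
move=> bA; have -> : [set x | exists i, A i x] = \bigcup_i [set x | A i x].
  by apply/seteqP; split=> x [i]; [exists i | move=> _ ?; exists i].
exact: sigma_algebra_bigcup.
Qed.

Lemma borel_all (X : topologicalType) (A : nat -> X -> Prop) :
  (forall i, borel_set [set x | A i x]) -> borel_set [set x | forall i, A i x].
Proof.
move=> bA.
have -> : [set x | forall i, A i x] = [set x | ~ exists i, ~ A i x].
  apply/seteqP; split=> x /=; first by move=> h [i]; apply.
  by move=> h i; apply: contrapT => ?; apply: h; exists i.
by apply: borel_not; apply: borel_ex => i; apply: borel_not; exact: bA.
Qed.

Lemma borel_and (X : topologicalType) (A B : X -> Prop) :
  borel_set [set x | A x] -> borel_set [set x | B x] ->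
  borel_set [set x | A x /\ B x].
Proof.
move=> bA bB; have -> : [set x | A x /\ B x] =
    [set x | forall i : nat, (if i is 0 then A else B) x].
  apply/seteqP; split=> x /=; first by case=> ? ? [|i].
  by move=> h; split; [exact: (h 0) | exact: (h 1)].
by apply: borel_all => -[|i].
Qed.

Lemma borel_or (X : topologicalType) (A B : X -> Prop) :
  borel_set [set x | A x] -> borel_set [set x | B x] ->
  borel_set [set x | A x \/ B x].
Proof.
move=> bA bB; have -> : [set x | A x \/ B x] =
    [set x | exists i : nat, (if i is 0 then A else B) x].
  apply/seteqP; split=> x /=; first by case=> ?; [exists 0 | exists 1].
  by case=> -[|i]; [left | right].
by apply: borel_ex => -[|i].
Qed.

Lemma borel_cst (X : topologicalType) (Q : Prop) : borel_set [set x : X | Q].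
Proof.
case: (pselect Q) => q; apply: borel_open.
  by rewrite (_ : [set x | Q] = setT); [exact: openT | apply/seteqP; split].
by rewrite (_ : [set x | Q] = set0); [exact: open0 | apply/seteqP; split].
Qed.

Lemma borel_imply (X : topologicalType) (A B : X -> Prop) :
  borel_set [set x | A x] -> borel_set [set x | B x] ->
  borel_set [set x | A x -> B x].
Proof.
move=> bA bB; have -> : [set x | A x -> B x] = [set x | ~ A x \/ B x].
  by apply/funext => x; exact: implyE.
by apply: borel_or => //; exact: borel_not.
Qed.

Lemma borel_fun_open (X : topologicalType) (f : X -> X) :
  (forall V, open V -> borel_set (f @^-1` V)) -> borel_fun f.
Proof.
move=> of_ B bB; rewrite setTI.
have : sigma_algebra setT [set B | borel_set (f @^-1` B)].
  split=> /=.
  - by rewrite preimage_set0; exact: sigma_algebra0.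
  - by move=> A bA; rewrite setTD; exact: borel_not.
  - by move=> F bF; rewrite preimage_bigcup; exact: sigma_algebra_bigcup.
by move=> /smallest_sub; apply; [exact: of_ | exact: bB].
Qed.

Lemma borel_fun_preimage (X : topologicalType) (f : X -> X) (B : set X) :
  borel_fun f -> borel_set B -> borel_set (f @^-1` B).
Proof. by move=> bf bB; have := bf _ bB; rewrite setTI. Qed.

Lemma borel_fun_comp (X : topologicalType) (f g : X -> X) :
  borel_fun f -> borel_fun g -> borel_fun (f \o g).
Proof. by move=> bf bg B bB; exact: bg _ (borel_fun_preimage _ _ _ bf bB). Qed.

Lemma borel_fun_restrict {X : topologicalType} (E : set X) (f : X -> X) :
  borel_set E -> borel_fun f -> borel_fun_on E f.
Proof.
by move=> bE bf B bB; exact: borel_and bE (borel_fun_preimage _ _ _ bf bB).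
Qed.

(** Disjointness makes the prescribed value unique. Off the union the value is the constant [x0], so
    the preimage of an open set is a countable union of relative preimages, joined with the
    complement of the union when [x0] lies in the open set. *)
Lemma borel_fun_glue (X : topologicalType) (x0 : X) (F : nat -> set X)
    (f : nat -> X -> X) :
  (forall n, borel_set (F n)) -> (forall n, borel_fun_on (F n) (f n)) ->
  (forall m n x, F m x -> F n x -> m = n) ->
  exists g, borel_fun g /\ forall n x, F n x -> g x = f n x.
Proof.
move=> bF bf dF.
have /choice[g gP] : forall x, exists y, (forall n, F n x -> y = f n x) /\
    ((forall n, ~ F n x) -> y = x0).
  move=> x; case: (pselect (exists n, F n x)) => [[n Fx]|nF].
    by exists (f n x); split=> [m /(dF _ _ _ Fx) ->//|/(_ n)].
  by exists x0; split=> // n Fx; case: nF; exists n.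
exists g; split; last by move=> n x; exact: (gP x).1.
apply: borel_fun_open => V oV.
have -> : g @^-1` V = [set x | (exists n, F n x /\ V (f n x)) \/
    ((forall n, ~ F n x) /\ V x0)].
  apply/seteqP; split=> x /=.
    move=> Vg; case: (pselect (exists n, F n x)) => [[n Fx]|nF].
      by left; exists n; rewrite -(gP x).1.
    have nF' : forall n, ~ F n x by move=> n ?; apply: nF; exists n.
    by right; split=> //; rewrite -(gP x).2.
  by move=> [[n [Fx]]|[nF]]; [rewrite -(gP x).1 | rewrite -(gP x).2].
apply: borel_or; first by apply: borel_ex => n; apply: bf; exact: borel_open.
apply: borel_and; last exact: borel_cst.
by apply: borel_all => n; apply: borel_not; exact: bF.
Qed.

(** * Small sets and nested intersections in complete spaces *)

Definition small {R : realType} {X : pseudoMetricType R} (n : nat) (A : set X) :=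
  forall x y, A x -> A y -> ball x (n.+1%:R^-1)%R y.

Lemma shrink_open (R : realType) (X : pseudoMetricType R) (n : nat)
    (A : set X) (x : X) : open A -> A x ->
  exists B, [/\ open B, B x, closure B `<=` A & small n B].
Proof.
move=> oA Ax.
have /nbhs_ballP[e /= e0 eA] : nbhs x A by exact: open_nbhs_nbhs.
(* The bound [e / 2] keeps the closure inside [A]; the other bound makes any two points of the ball
   close enough for [small n]. *)
pose d := Num.min (e / 2)%R (n.+1%:R^-1 / 2)%R.
have d0 : (0 < d)%R by rewrite lt_min !divr_gt0 // ?invr_gt0 ?ltr0n.
have de : (d <= e / 2)%R by rewrite ge_min lexx.
have dn : (d <= n.+1%:R^-1 / 2)%R by rewrite ge_min lexx orbT.
exists (ball x d)^°; split.
- exact: open_interior.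
- exact: nbhsx_ballx.
- move=> z /(_ (ball z d)) []; first exact: nbhsx_ballx.
  move=> w [/interior_subset xw zw]; apply: eA.
  by apply: (ball_splitl (z := w)); exact: le_ball de _ _.
- move=> y z /interior_subset xy /interior_subset xz.
  by apply: (ball_splitr (z := x)); exact: le_ball dn _ _.
Qed.

Lemma small_unique (R : realType) (X : pseudoMetricType R) (C : nat -> set X)
    (x y : X) : hausdorff_space X -> (forall n, small n (C n)) ->
  (forall n, C n x) -> (forall n, C n y) -> x = y.
Proof.
move=> hX sC Cx Cy; apply: hX => A B /nbhs_ballP[e /= e0 eA] nB.
have [N _ /(_ N (leqnn N)) lNe] := near_infty_natSinv_lt (PosNum e0).
exists y; split; last exact: nbhs_singleton.
apply: eA; apply: le_ball (ltW lNe) _ _; exact: sC.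
Qed.

(** Points chosen in [C n] and [P] form a Cauchy sequence; its limit lies in each
    [closure (C n.+1)], hence in [C n]. Smallness starts at index 1, so [C 0] may be the whole
    space. *)
Lemma nested_point (R : realType) (X : completePseudoMetricType R)
    (P : set X) (C : nat -> set X) : closed P ->
  (forall n, C n `&` P !=set0) -> (forall n, closure (C n.+1) `<=` C n) ->
  (forall n, small n (C n.+1)) -> exists x, P x /\ forall n, C n x.
Proof.
move=> cP /choice[c cCP] clC sC.
have dec m n : (m <= n)%N -> C n `<=` C m.
  elim: n => [|n IH]; first by rewrite leqn0 => /eqP ->.
  rewrite leq_eqVlt => /predU1P[->//|/IH h].
  by apply: subset_trans h; apply: subset_trans (@subset_closure _ _) (clC n).
have : cauchy (c @ \oo).
  apply: cauchy_exP => e e0.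
  have [N _ /(_ N (leqnn N)) lNe] := near_infty_natSinv_lt (PosNum e0).
  exists (c N.+1); exists N.+1 => // n /= Nn.
  apply: le_ball (ltW lNe) _ _; apply: sC; first by case: (cCP N.+1).
  by apply: (dec _ _ Nn); case: (cCP n).
move=> /cauchy_cvg/cvg_ex[x cx]; exists x; split.
  by apply: (closed_cvg P cP _ x cx); exists 0 => // n _; case: (cCP n).
move=> n; apply: clC.
apply: (closed_cvg _ (@closed_closure _ (C n.+1)) _ x cx); exists n.+1 => // m.
by move=> /= nm; apply: subset_closure; apply: (dec _ _ nm); case: (cCP m).
Qed.

(** * Cantor schemes and Borel maps through the Cantor space *)

Lemma perfect_split (R : realType) (X : pseudoMetricType R) (P C : set X)
    (n : nat) : hausdorff_space X -> perfect_set P -> open C ->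
  C `&` P !=set0 -> exists B : bool -> set X,
  (forall b, [/\ open (B b), B b `&` P !=set0, closure (B b) `<=` C &
                 small n (B b)]) /\ forall x, B true x -> B false x -> False.
Proof.
move=> hX [_ lP] oC [p [Cp Pp]].
have [q [qp Pq Cq]] : exists q, [/\ q != p, P q & C q].
  by move: Pp; rewrite -[in X in X -> _]lP; apply; exact: open_nbhs_nbhs.
move: hX; rewrite open_hausdorff => /(_ _ _ qp)[[A B]] /=.
rewrite !inE => -[Aq Bp] [oA oB AB0].
have [A' [oA' A'q clA' sA']] := shrink_open _ _ n _ _ (openI oA oC) (conj Aq Cq).
have [B' [oB' B'p clB' sB']] := shrink_open _ _ n _ _ (openI oB oC) (conj Bp Cp).
exists (fun b => if b then A' else B'); split.
  case; split=> //; [by exists q | | by exists p | ].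
    by move=> x /clA' [].
  by move=> x /clB' [].
move=> x /(@subset_closure _ _ _)/clA'[Ax _] /(@subset_closure _ _ _)/clB'[Bx _].
by have : (A `&` B) x by []; rewrite AB0.
Qed.

(** The node is indexed by an infinite branch [sigma], of which only the first [n] bits are read. *)
Fixpoint scheme {X : Type} (step : nat -> set X -> bool -> set X)
    (sigma : nat -> bool) (n : nat) : set X :=
  if n is m.+1 then step m (scheme step sigma m) (sigma m) else setT.

Lemma perfect_cantor_map (R : realType) (X : completePseudoMetricType R)
    (P : set X) : hausdorff_space X -> nonempty_perfect P ->
  exists s : X -> nat -> bool, (forall n, borel_set [set x | s x n]) /\
    forall sigma, exists p, P p /\ s p = sigma.
Proof.
move=> hX [pP [p0 Pp0]].
have /choice[step0 stepP0] : forall nC : nat * set X, exists B : bool -> set X,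
    open nC.2 -> nC.2 `&` P !=set0 ->
    (forall b, [/\ open (B b), B b `&` P !=set0, closure (B b) `<=` nC.2 &
                 small nC.1 (B b)]) /\ forall x, B true x -> B false x -> False.
  move=> [n C] /=; case: (pselect (open C /\ C `&` P !=set0)) => [[oC CP]|nC].
    by have [B ?] := perfect_split _ _ _ _ n hX pP oC CP; exists B.
  by exists (fun=> set0) => oC CP; case: nC.
pose step n C := step0 (n, C); pose S := scheme step.
have SP sigma n : open (S sigma n) /\ S sigma n `&` P !=set0.
  elim: n => [|n [oS SP]]; first by split; [exact: openT | exists p0].
  by have [/(_ (sigma n))[]] := stepP0 (n, S sigma n) oS SP.
have SS sigma n b : [/\ open (step n (S sigma n) b),
    step n (S sigma n) b `&` P !=set0,
    closure (step n (S sigma n) b) `<=` S sigma n &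
    small n (step n (S sigma n) b)].
  have [oS SP'] := SP sigma n.
  by have [/(_ b)] := stepP0 (n, S sigma n) oS SP'.
have Sdec sigma n : S sigma n.+1 `<=` S sigma n.
  have [_ _ cl _] := SS sigma n (sigma n).
  exact: subset_trans (@subset_closure _ _) cl.
have Sbit x sigma tau n : S sigma n = S tau n ->
    S sigma n.+1 x -> S tau n.+1 x -> sigma n = tau n.
  have [oS SP'] := SP sigma n.
  have [_ dis] := stepP0 (n, S sigma n) oS SP'.
  rewrite /S /= -!/(S _ _) => <-.
  by case: (sigma n); case: (tau n) => // ? ?; case: (dis x).
(* Nodes of the same level that share a point coincide, because siblings are disjoint. *)
have Seq x sigma tau n : S sigma n x -> S tau n x -> S sigma n = S tau n.
  elim: n => // n IH Sx Tx.
  have e := IH (Sdec _ _ _ Sx) (Sdec _ _ _ Tx).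
  by rewrite /S /= -!/(S _ _) -e (Sbit _ _ _ _ e Sx Tx).
(* Bit [n] of [x] is 1 when [x] lies in a node of level [n.+1] whose last bit is 1. This is an open
   condition, and it also gives a value to points on no branch. *)
exists (fun x n => `[< exists sigma : nat -> bool, sigma n /\ S sigma n.+1 x >]); split.
  move=> n; apply: borel_open.
  have -> : [set x | `[< exists sigma : nat -> bool, sigma n /\ S sigma n.+1 x >]] =
      \bigcup_(sigma in [set sigma : nat -> bool | sigma n]) S sigma n.+1.
    apply/seteqP; split=> x /=.
      by move=> /asboolP[sigma [? ?]]; exists sigma.
    by move=> [sigma ? ?]; apply/asboolP; exists sigma.
  by apply: bigcup_open => sigma _; exact: (SP sigma n.+1).1.
move=> sigma.
have [|||p [Pp Sp]] := @nested_point _ _ P (S sigma) pP.1.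
- by move=> n; exact: (SP sigma n).2.
- by move=> n; have [] := SS sigma n (sigma n).
- by move=> n; have [] := SS sigma n (sigma n).
exists p; split=> //; apply/funext => n; apply/asboolP/idP.
  move=> [tau [tn Tp]].
  by rewrite (Sbit _ _ _ _ (Seq _ _ _ _ (Sp n) (Sdec _ _ _ Tp)) (Sp n.+1) Tp).
by exists sigma.
Qed.

(* A sequence [sigma] of bits codes the point x when the pairs (i, k) with
   bit 1 list basic sets [U k] shrinking to x as i grows. *)
Lemma borel_coding (R : realType) (X : completePseudoMetricType R)
    (U : nat -> set X) : hausdorff_space X -> is_base U ->
  exists D : (nat -> bool) -> X, (forall x, exists sigma, D sigma = x) /\
    forall s : X -> nat -> bool, (forall n, borel_set [set x | s x n]) ->
      borel_fun (D \o s).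
Proof.
move=> hX [oU bU].
pose bit (sigma : nat -> bool) (i k : nat) : bool := sigma (pickle (i, k)).
(* A level may list several [k]; nesting is demanded of every choice, so each listed set contains
   the limit point. Codes that are not good are sent to [point]. *)
pose good (sigma : nat -> bool) := (forall i, exists k, bit sigma i k) /\
  forall i k k', bit sigma i k -> bit sigma i.+1 k' ->
    closure (U k') `<=` U k /\ small i (U k').
have /choice[D DP] : forall sigma, exists x,
    (good sigma -> forall i k, bit sigma i k -> U k x) /\
    (~ good sigma -> x = point).
  move=> sigma; case: (pselect (good sigma)) => [g|]; last by exists point.
  have [/choice[kk kkP] gP] := g.
  have [|||x [_ Ux]] := @nested_point _ _ setT (U \o kk) closedT.
  - by move=> n /=; rewrite setIT; exact: (oU _).2.
  - by move=> n /=; exact: (gP n _ _ (kkP n) (kkP n.+1)).1.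
  - by move=> n /=; exact: (gP n _ _ (kkP n) (kkP n.+1)).2.
  exists x; split=> // _ i k ik.
  by apply: (gP i _ _ ik (kkP i.+1)).1; apply: subset_closure; exact: Ux.
exists D; split.
  move=> x.
  have /choice[nxt nxtP] : forall ik : nat * nat, exists k', U ik.2 x ->
      [/\ U k' x, closure (U k') `<=` U ik.2 & small ik.1 (U k')].
    move=> [i k] /=; case: (pselect (U k x)) => [Ux|]; last by exists 0.
    have [B [oB Bx clB sB]] := shrink_open _ _ i _ _ (oU k).1 Ux.
    have [k' [Ux' UB]] := bU _ oB _ Bx; exists k' => _; split=> //.
      exact: subset_trans (closure_subset UB) clB.
    by move=> y z /UB By /UB Bz; exact: sB.
  have [k0 [Ux0 _]] := bU _ openT x Logic.I.
  pose kk := fix kk i := if i is j.+1 then nxt (j, kk j) else k0.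
  have Ukk i : U (kk i) x by elim: i => //= i IH; have [] := nxtP (i, kk i) IH.
  pose sigma m := if @unpickle (nat * nat)%type m is Some ik
                  then ik.2 == kk ik.1 else false.
  have bitE i k : bit sigma i k = (k == kk i).
    by rewrite /bit /sigma pickleK.
  have gs : good sigma.
    split=> [i|i k k']; first by exists (kk i); rewrite bitE.
    rewrite !bitE => /eqP -> /eqP ->.
    by have [] := nxtP (i, kk i) (Ukk i).
  exists sigma; apply: (@small_unique _ _ (fun i => U (kk i.+1))) => // i.
    by have [] := nxtP (i, kk i) (Ukk i).
  by apply: (DP sigma).1 => //; rewrite bitE.
move=> s bs; apply: borel_fun_open => V oV.
(* For a good code, membership in [V] is detected by a listed basic set contained in [V]. The
   inclusion does not depend on [x], so only countably many conditions on bits remain. *)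
have -> : (D \o s) @^-1` V = [set x |
    (good (s x) /\ exists i k, bit (s x) i k /\ U k `<=` V) \/
    (~ good (s x) /\ V point)].
  apply/seteqP; split=> x /=.
    move=> VD; case: (pselect (good (s x))) => g; last first.
      by right; split=> //; rewrite -((DP (s x)).2 g).
    left; split=> //; have UD := (DP (s x)).1 g; have [ex nest] := g.
    have /nbhs_ballP[e /= e0 eV] : nbhs (D (s x)) V by exact: open_nbhs_nbhs.
    have [N _ /(_ N (leqnn N)) lNe] := near_infty_natSinv_lt (PosNum e0).
    (* [small N] is imposed on level [N.+1], in passing from level [N]. *)
    have [k Nk] := ex N; have [k' Nk'] := ex N.+1.
    exists N.+1, k'; split=> // y Uy; apply: eV.
    apply: le_ball (ltW lNe) _ _; apply: (nest _ _ _ Nk Nk').2 => //.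
    exact: UD Nk'.
  move=> [[g [i [k [ik UV]]]]|[ng Vp]]; last by rewrite (DP (s x)).2.
  by apply: UV; exact: (DP (s x)).1 ik.
have bbit i k : borel_set [set x | bit (s x) i k] by exact: bs.
have bgood : borel_set [set x | good (s x)].
  apply: borel_and; first by apply: borel_all => i; apply: borel_ex => k; exact: bbit.
  apply: borel_all => i; apply: borel_all => k; apply: borel_all => k'.
  apply: borel_imply; first exact: bbit.
  by apply: borel_imply; [exact: bbit | exact: borel_cst].
apply: borel_or; apply: borel_and => //.
- apply: borel_ex => i; apply: borel_ex => k.
  by apply: borel_and; [exact: bbit | exact: borel_cst].
- exact: borel_not.
- exact: borel_cst.
Qed.

Lemma borel_surj_perfect (R : realType) (X : completePseudoMetricType R)
    (U : nat -> set X) (P : set X) : hausdorff_space X -> is_base U ->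
  nonempty_perfect P ->
  exists h, borel_fun h /\ forall y, exists p, P p /\ h p = y.
Proof.
move=> hX bU pP.
have [s [bs sP]] := perfect_cantor_map _ _ _ hX pP.
have [D [Donto bD]] := borel_coding _ _ _ hX bU.
exists (D \o s); split; first exact: bD.
move=> y; have [sigma <-] := Donto y; have [p [Pp <-]] := sP sigma.
by exists p.
Qed.

(** The even and the odd bits of one Cantor sequence code the two coordinates. *)
Lemma borel_pairing (R : realType) (X : completePseudoMetricType R)
    (U : nat -> set X) : hausdorff_space X -> is_base U ->
  nonempty_perfect [set: X] ->
  exists p q : X -> X, [/\ borel_fun p, borel_fun q &
    forall y z, exists x, p x = y /\ q x = z].
Proof.
move=> hX bU pP.
have [s [bs sP]] := perfect_cantor_map _ _ _ hX pP.
have [D [Donto bD]] := borel_coding _ _ _ hX bU.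
exists (D \o fun x n => s x n.*2), (D \o fun x n => s x n.*2.+1).
split; [by apply: bD| by apply: bD|] => y z.
have [sigma <-] := Donto y; have [tau <-] := Donto z.
have [x [_ sx]] := sP (fun n => if odd n then tau n./2 else sigma n./2).
exists x; rewrite /= sx; split; congr D; apply/funext => n /=.
  by rewrite odd_double doubleK.
by rewrite odd_double /= uphalf_double.
Qed.

(** * Splitting and carving sets with positive fibres *)

(* The variant of [propM] with a total Borel function: equivalent to it for
   Borel E, but monotone in E without any measurability condition. *)
Definition posM {X : topologicalType} (I : set (set X)) (E : set X) : Prop :=
  exists g : X -> X, borel_fun g /\ forall y, ~ I (E `&` g @^-1` [set y]).

Lemma propM_posM (X : ptopologicalType) (I : set (set X)) (E : set X) :
  borel_set E -> propM I E -> posM I E.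
Proof.
move=> bE [g [bg gP]].
(* Index 0 carries [E] and the other pieces are empty, so gluing extends [g] from [E] to a total
   Borel function. *)
have [n|n||f [bf fg]] := @borel_fun_glue X point
    (fun n => if n is 0 then E else set0) (fun=> g).
- by case: n => // _; apply: borel_open; exact: open0.
- by case: n => // n B _; rewrite set0I; apply: borel_open; exact: open0.
- by move=> [|m] [|n].
exists f; split=> // y; rewrite (_ : _ `&` _ = E `&` g @^-1` [set y]) //.
by apply/seteqP; split=> x /= [Ex]; rewrite (fg 0).
Qed.

Lemma posM_propM {X : topologicalType} (I : set (set X)) (E : set X) :
  borel_set E -> posM I E -> propM I E.
Proof.
by move=> bE [g [bg gP]]; exists g; split=> //; exact: borel_fun_restrict.
Qed.

Lemma posMS {X : topologicalType} (I : set (set X)) (E F : set X) :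
  is_ideal I -> E `<=` F -> posM I E -> posM I F.
Proof.
move=> [Isub _ _ _] EF [g [bg gP]]; exists g; split=> // y IF.
by apply: (gP y); apply: Isub IF _; exact: setSI.
Qed.

(** If [p \o g] had a fibre over [y] in [I] on [E] minus [A], and [q \o g] one over [z] on the rest
    of [E], then the [g]-fibre of an [x] with [p x = y] and [q x = z] would be covered by the
    two. *)
Lemma posM_split {X : topologicalType} (I : set (set X)) (p q : X -> X)
    (E A : set X) : is_ideal I -> borel_fun p -> borel_fun q ->
  (forall y z, exists x, p x = y /\ q x = z) ->
  posM I E -> ~ posM I (E `\` A) -> posM I (E `&` A).
Proof.
move=> [Isub IU _ _] bp bq pq [g [bg gP]] nD; apply: contrapT => nI.
have [y Iy] : exists y, I ((E `\` A) `&` (p \o g) @^-1` [set y]).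
  apply: contrapT => h; apply: nD; exists (p \o g).
  by split; [exact: borel_fun_comp | move=> y ?; apply: h; exists y].
have [z Iz] : exists z, I ((E `&` A) `&` (q \o g) @^-1` [set z]).
  apply: contrapT => h; apply: nI; exists (q \o g).
  by split; [exact: borel_fun_comp | move=> z ?; apply: h; exists z].
have [x [px qx]] := pq y z; apply: (gP x); apply: Isub (IU _ _ Iy Iz) _.
move=> t [Et /= gt]; case: (pselect (A t)) => At; [right|left]; split=> //=.
  by rewrite gt.
by rewrite gt.
Qed.

(* For each m at most one fibre of p \o g can exhaust [E m `&` A] up to a
   non-[posM] set, so an uncountable space has a fibre good for all m. *)
Lemma posM_carve {X : topologicalType} (I : set (set X)) (p q : X -> X)
    (E : nat -> set X) (A : set X) (n : nat) : ~ countable [set: X] ->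
  hausdorff_space X ->
  is_ideal I -> borel_fun p -> borel_fun q ->
  (forall y z, exists x, p x = y /\ q x = z) ->
  borel_set A -> (forall m, posM I (E m `&` A)) ->
  exists B, [/\ B `<=` A, borel_set B, posM I (E n `&` (A `\` B)) &
                forall m, posM I (E m `&` B)].
Proof.
move=> unc hX hI bp bq pq bA EA; have [g [bg gP]] := EA n.
pose F y := (p \o g) @^-1` [set y].
pose bad m := [set y | ~ posM I ((E m `&` A) `\` F y)].
have bad1 m y z : bad m y -> bad m z -> y = z.
  move=> by_ bz; apply: contrapT => yz.
  apply: bz; apply: posMS hI _ (posM_split _ _ _ _ _ hI bp bq pq (EA m) by_).
  by move=> t [EAt /= Fy]; split=> // Fz; apply: yz; rewrite -Fy -Fz.
have [y ny] : exists y, forall m, ~ bad m y.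
  apply: contrapT => h; apply: unc.
  have : countable (\bigcup_m bad m).
    apply: bigcup_countable => // m _.
    case: (pselect (bad m !=set0)) => [[z bz]|/nonemptyPn ->]; last first.
      exact: countable0.
    apply: sub_countable (countable1 z); apply: subset_card_le => w bw.
    exact: bad1 bw bz.
  apply: sub_countable; apply: subset_card_le => y _; apply: contrapT => nb.
  by apply: h; exists y => m bm; apply: nb; exists m.
have bF : borel_set (F y).
  apply: borel_fun_preimage; first exact: borel_fun_comp.
  exact: borel_set1.
exists (A `\` F y); split.
- exact: subDsetl.
- by apply: borel_and => //; exact: borel_not.
(* On the removed piece [F y], the fibre of [q \o g] over [z] contains the [g]-fibre of a point [x]
   paired from [y] and [z]. *)
- exists (q \o g); split; first exact: borel_fun_comp.
  move=> z; have [x [px qx]] := pq y z; move: (gP x); apply: contra_not.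
  case: hI => Isub _ _ _ /Isub; apply=> t [[Et At] /= gt].
  split; last by rewrite /= gt.
  by split=> //; split=> // -[_]; apply; rewrite /F /= gt.
- by move=> m; have /contrapT := ny m; rewrite setIDA.
Qed.

(** Stage [n] keeps a reserve [A n.+1] still positive for every [E m] and releases the ring between
    [A n] and [A n.+1] to serve [E n]. The rings are disjoint, so their witnesses can be glued. *)
Lemma posM_common {X : ptopologicalType} (I : set (set X)) (p q : X -> X)
    (E : nat -> set X) : ~ countable [set: X] -> hausdorff_space X ->
  is_ideal I -> borel_fun p -> borel_fun q ->
  (forall y z, exists x, p x = y /\ q x = z) -> (forall n, posM I (E n)) ->
  exists f, borel_fun f /\ forall n y, ~ I (E n `&` f @^-1` [set y]).
Proof.
move=> unc hX hI bp bq pq EM.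
have /choice[nxt nxtP] : forall nA : nat * set X, exists B,
    borel_set nA.2 -> (forall m, posM I (E m `&` nA.2)) ->
    [/\ B `<=` nA.2, borel_set B, posM I (E nA.1 `&` (nA.2 `\` B)) &
        forall m, posM I (E m `&` B)].
  move=> [n A] /=.
  case: (pselect (borel_set A /\ forall m, posM I (E m `&` A))) => [[bA EA]|nA].
    by have [B ?] := posM_carve _ _ _ _ _ n unc hX hI bp bq pq bA EA; exists B.
  by exists set0 => bA EA; case: nA.
pose A := fix A n := if n is m.+1 then nxt (m, A m) else setT.
have AP n : borel_set (A n) /\ forall m, posM I (E m `&` A n).
  elim: n => [|n [bA EA]]; last by have [] := nxtP (n, A n) bA EA.
  by split=> [|m]; [apply: borel_open; exact: openT | rewrite setIT].
have AS n : A n.+1 `<=` A n /\ posM I (E n `&` (A n `\` A n.+1)).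
  by have [bA EA] := AP n; have [] := nxtP (n, A n) bA EA.
have dec m n : (m <= n)%N -> A n `<=` A m.
  elim: n => [|n IH]; first by rewrite leqn0 => /eqP ->.
  rewrite leq_eqVlt => /predU1P[->//|/IH h].
  exact: subset_trans (AS n).1 h.
have /choice[g gP] : forall n, posM I (E n `&` (A n `\` A n.+1)).
  by move=> n; exact: (AS n).2.
have bF n : borel_set (A n `\` A n.+1).
  apply: borel_and; first exact: (AP n).1.
  by apply: borel_not; exact: (AP n.+1).1.
have [n|m n x|f [bf fg]] := @borel_fun_glue X point _ g bF.
- by apply: borel_fun_restrict => //; exact: (gP n).1.
- move=> [Am nAm] [An nAn]; case: (ltngtP m n) => // mn.
    by case: nAm; exact: (dec _ _ mn).
  by case: nAn; exact: (dec _ _ mn).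
exists f; split=> // n y; have := (gP n).2 y; apply: contra_not.
case: hI => Isub _ _ _ /Isub; apply=> x [[Ex Fx] /= gx]; split=> //=.
by rewrite (fg n).
Qed.

(** * Deduction of the four claims from common witnesses and Borel surjections *)

Theorem theorem6p3 (R : realType) (X : completePseudoMetricType R)
  (hX : hausdorff_space X) (sepX : separable_space X) (uncX : ~ countable [set: X])
  (I : set (set X)) (hI : is_ideal I)
  (hopen : forall V : set X, open V -> V !=set0 -> ~ I V)
  (U : nat -> set X) (hU : is_base U) :
  (forall x : X, propM'x I x <->
     exists f : X -> X, borel_fun f /\
       forall n, U n x -> exists P, nonempty_perfect P /\ P `<=` Hn I U f n) /\
  (propM' I <->
     exists f : X -> X, borel_fun f /\
       forall n, exists P, nonempty_perfect P /\ P `<=` Hn I U f n) /\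
  (propMstar I <->
     exists f : X -> X, borel_fun f /\
       exists P, nonempty_perfect P /\ P `<=` \bigcap_n Hn I U f n) /\
  (is_sigma_ideal I -> forall f : X -> X, borel_fun f ->
     (forall x : X, ~ I (f @^-1` [set x])) ->
     (forall n, countable (Hn I U f n) \/
                exists P, nonempty_perfect P /\ P `<=` Hn I U f n) ->
     exists x : X, propM'x I x).
Proof.
have [Isub _ I1 _] := hI; have [oU bU] := hU.
have perfX : nonempty_perfect [set: X].
  split; last by exists point.
  by apply/perfectTP => x ox; apply: (hopen _ ox); [exists x | exact: I1].
have [p [q [bp bq pq]]] := borel_pairing _ _ _ hX hU perfX.
have common (E : nat -> set X) : (forall n, borel_set (E n)) -> (forall n, propM I (E n)) ->
    exists f, borel_fun f /\ forall n y, ~ I (E n `&` f @^-1` [set y]).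
  move=> bE EM; apply: posM_common uncX hX hI bp bq pq _ => n.
  by apply: propM_posM; [exact: bE | exact: EM].
have collapse f P V n : borel_fun f -> nonempty_perfect P ->
    P `<=` Hn I U f n -> open V -> U n `<=` V -> propM I V.
  move=> bf pP PH oV UV; have [h [bh hP]] := borel_surj_perfect _ _ _ _ hX hU pP.
  apply: posM_propM; first exact: borel_open.
  exists (h \o f); split; first exact: borel_fun_comp.
  move=> y; have [z [Pz hz]] := hP y; apply: contra_not (PH _ Pz) => /Isub; apply.
  by move=> t [Ut /= ft]; split; [exact: UV | rewrite /= ft].
have local x : (exists f : X -> X, borel_fun f /\ forall n, U n x ->
    exists P, nonempty_perfect P /\ P `<=` Hn I U f n) -> propM'x I x.
  move=> [f [bf fP]] V oV Vx; have [n [Ux UV]] := bU _ oV _ Vx.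
  by have [P [pP PH]] := fP n Ux; exact: collapse bf pP PH oV UV.
split; [|split; [|split]].
- move=> x; split=> [Mx|]; last exact: local.
  (* The default [setT] is also a neighborhood of [x], so (M) holds relative to every [E n]. *)
  pose E n := if `[< U n x >] then U n else setT.
  have oE n : open (E n) /\ E n x.
    rewrite /E; case: asboolP => Ux; split=> //; last exact: openT.
    exact: (oU n).1.
  have [n|n|f [bf fP]] := common E.
  + by apply: borel_open; exact: (oE n).1.
  + by apply: Mx; [exact: (oE n).1 | exact: (oE n).2].
  exists f; split=> // n Ux; exists setT; split=> // y _.
  by have := fP n y; rewrite /E; case: asboolP.
- split=> [M|[f [bf fP]] V oV [x Vx]].
    have [n|n|f [bf fP]] := common U.
    + by apply: borel_open; exact: (oU n).1.
    + by apply: M; [exact: (oU n).1 | exact: (oU n).2].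
    by exists f; split=> // n; exists setT; split=> // y _; exact: fP.
  have [n [_ UV]] := bU _ oV _ Vx; have [P [pP PH]] := fP n.
  exact: collapse bf pP PH oV UV.
- split=> [[g [bg gP]]|[f [bf [P [pP PH]]]]].
    exists g; split=> //; exists setT; split=> // y _ n _.
    by rewrite /Hn /= setIC; apply: gP; [exact: (oU n).1 | exact: (oU n).2].
  have [h [bh hP]] := borel_surj_perfect _ _ _ _ hX hU pP.
  exists (h \o f); split; first exact: borel_fun_comp.
  move=> y V oV [x Vx]; have [n [_ UV]] := bU _ oV _ Vx.
  have [z [Pz hz]] := hP y; apply: contra_not (PH _ Pz n Logic.I) => /Isub; apply.
  by move=> t [Ut /= ft]; split; [rewrite /= ft | exact: UV].
- move=> [_ Isig] f bf fI Hc.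
  pose C n := if `[< countable (Hn I U f n) >] then Hn I U f n else set0.
  have [y nCy] : exists y, ~ (\bigcup_n C n) y.
    apply: contrapT => h; apply: uncX.
    have : countable (\bigcup_n C n).
      apply: bigcup_countable => // n _; rewrite /C.
      by case: asboolP => // _; exact: countable0.
    apply: sub_countable; apply: subset_card_le => y _.
    by apply: contrapT => nC; apply: h; exists y.
  (* Since [y] avoids every countable [Hn I U f n], each [T n] is in [I], and the sigma-ideal
     property puts their union in [I]. *)
  pose T n := if `[< countable (Hn I U f n) >]
              then U n `&` f @^-1` [set y] else set0.
  have IT : I (\bigcup_n T n).
    apply: Isig => n; rewrite /T; case: asboolP => cH; last first.
      by apply: Isub (I1 point) _; exact: sub0set.
    apply: contrapT => nI; apply: nCy; exists n => //.
    by rewrite /C; case: asboolP.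
  have [x [fx nT]] : exists x, f x = y /\ ~ (\bigcup_n T n) x.
    apply: contrapT => h; apply: (fI y); apply: Isub IT _ => x fx.
    by apply: contrapT => nT; apply: h; exists x.
  exists x; apply: local; exists f; split=> // n Ux.
  (* With [U n x] and [f x = y], countability of [Hn I U f n] would place [x] in [T n]. *)
  case: (Hc n) => // cH; case: nT; exists n => //.
  by rewrite /T; case: asboolP.
Qed.
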